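(* Let $A$ be a ring and let $B$ and $C$ be $A$-algebras. (1) There is a unique ring structure on $B\otimes_A C$ such that $(b_1\otimes c_1)(b_2\otimes c_2)=b_1b_2\otimes c_1c_2$ whenever $b_1,b_2\in B$, $c_1,c_2\in C$ and either $b_1,b_2\in C_B(A)$ or $c_1,c_2\in C_C(A)$. (2) For an object $D$ of $(\mathrm{Rings}/A)$ we have a bijection $$\mathrm{Hom}_{(\mathrm{Rings}/A)}(B\otimes_A C,D)\to\{(f,g)\in \mathrm{Hom}_{(\mathrm{Rings}/A)}(B,D)\times \mathrm{Hom}_{(\mathrm{Rings}/A)}(C,D)\;|\; f(b)g(c)=g(c)f(b)\text{ for all } b\in C_B(A),\ c\in C_C(A)\},$$ where an element $h$ of the first set corresponds to an element $(f,g)$ of the second set by $$f(b)=h(b\otimes 1),\quad g(c)=h(1\otimes c),\quad h(b\otimes c)=f(b)g(c)\qquad (b\in B,\ c\in C).$$ In the definition of the second set, ''$b\in C_B(A)$, $c\in C_C(A)$'' can be replaced by ''$b\in B$, $c\in C_C(A)$'', and also by ''$b\in C_B(A)$, $c\in C$'', without changing the second set. (3) With the ring homomorphism $B\to B\otimes_A C$, $b\mapsto b\otimes 1$, $B\otimes_A C$ is a $B$-algebra. With the ring homomorphism $C\to B\otimes_A C$, $c\mapsto 1\otimes c$, $B\otimes_A C$ is a $C$-algebra. With the ring homomorphism $A\to B\otimes_A C$, $a\mapsto a\otimes 1=1\otimes a$, $B\otimes_A C$ is an $A$-algebra.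
   Context: All rings are associative with $1$ (not necessarily commutative); ring homomorphisms preserve $1$. For a ring homomorphism $A\to B$, $C_B(A)$ denotes the centralizer in $B$ of the image of $A$. A ring $B$ with a ring homomorphism $A\to B$ is an $A$-algebra if $B$ is generated as a ring by the image of $A$ and $C_B(A)$. $B\otimes_A C$ is the tensor product of the right $A$-module $B$ and the left $A$-module $C$ (an abelian group); ''ring structure'' means a multiplication on this abelian group. $(\mathrm{Rings}/A)$ is the category of rings endowed with a ring homomorphism from $A$, with morphisms the ring homomorphisms compatible with the homomorphisms from $A$. In (2), $B\otimes_A C$ carries the ring structure of (1) and the homomorphism $a\mapsto a\otimes 1=1\otimes a$ from $A$. *)

(* Defs.v *)
From HB Require Import structures.
From mathcomp Require Import all_boot all_algebra.
From mathcomp Require Import boolp.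
From mathcomp Require Import freeg.

Set Implicit Arguments.
Unset Strict Implicit.
Unset Printing Implicit Defensive.

Import GRing.Theory.
Local Open Scope ring_scope.
Local Open Scope quotient_scope.

(* Rings are [pzRingType]s, so that the zero ring is allowed. *)

(* Objects and morphisms of the category (Rings/A). *)
Record ring_under (A : pzRingType) := RingUnder {
  under_ring :> pzRingType;
  under_map : {rmorphism A -> under_ring}
}.

Record under_hom (A : pzRingType) (X Y : ring_under A) := UnderHom {
  under_hom_fun :> {rmorphism X -> Y};
  under_homP : forall a, under_hom_fun (under_map X a) = under_map Y a
}.

Section Algebra.
Variables (A : pzRingType) (B : ring_under A).

Definition centralizer (b : B) : Prop :=
  forall a, GRing.comm b (under_map B a).

(* Every subring containing the image of A and its centralizer is all of B.
   Subrings are boolean predicates; as [boolp] is available, these are the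
   same as arbitrary subsets. *)
Definition is_algebra : Prop :=
  forall S : {pred B}, subring_closed S ->
    (forall a, under_map B a \in S) ->
    (forall b, centralizer b -> b \in S) ->
  forall b, b \in S.

End Algebra.

(* The abelian group B (x)_A C: the free abelian group on B * C modulo the
   subgroup generated by the biadditivity and A-balancing relators, where
   b . a = b * under_map B a and a . c = under_map C a * c. *)
Section Tensor.
Variables (A : pzRingType) (B C : ring_under A).

Local Notation gen b c := ([freeg [:: (1%:Z, ((b : B), (c : C)))]] : {freeg (B * C)}).

Inductive tensor_relator : {freeg (B * C)} -> Prop :=
| relator_addl b1 b2 c :
    tensor_relator (gen (b1 + b2) c - (gen b1 c + gen b2 c))
| relator_addr b c1 c2 :
    tensor_relator (gen b (c1 + c2) - (gen b c1 + gen b c2))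
| relator_bal b a c :
    tensor_relator (gen (b * under_map B a) c - gen b (under_map C a * c)).

Definition tensor_relations : {pred {freeg (B * C)}} := fun x =>
  `[< forall S : {pred {freeg (B * C)}}, zmod_closed S ->
        (forall y, tensor_relator y -> y \in S) -> x \in S >].

Lemma tensor_relations_zmod_closed : zmod_closed tensor_relations.
Proof.
split; first by apply/asboolP => S [].
move=> x y /asboolP xR /asboolP yR; apply/asboolP => S S_closed S_rel.
by apply: S_closed.2; [apply: xR | apply: yR].
Qed.

HB.instance Definition _ :=
  GRing.isZmodClosed.Build _ tensor_relations tensor_relations_zmod_closed.

Local Notation Q := (Quotient.quot tensor_relations).

Definition tensor : zmodType := Q.

Definition tens (b : B) (c : C) : tensor := \pi_Q (gen b c).

Lemma tensor_relatorP x y : tensor_relator (x - y) -> \pi_Q x = \pi_Q y.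
Proof.
move=> xyR; apply/eqP; rewrite -Quotient.idealrBE.
by apply/asboolP => S _; apply.
Qed.

Lemma tensDl b1 b2 c : tens (b1 + b2) c = tens b1 c + tens b2 c.
Proof.
by rewrite /tens (tensor_relatorP (relator_addl b1 b2 c)) Quotient.pi_add.
Qed.

Lemma tensDr b c1 c2 : tens b (c1 + c2) = tens b c1 + tens b c2.
Proof.
by rewrite /tens (tensor_relatorP (relator_addr b c1 c2)) Quotient.pi_add.
Qed.

Lemma tens_bal b a c :
  tens (b * under_map B a) c = tens b (under_map C a * c).
Proof. exact: tensor_relatorP (relator_bal b a c). Qed.

Lemma tensor_ind (P : tensor -> Prop) :
    P 0 -> (forall b c, P (tens b c)) ->
    (forall x, P x -> P (- x)) -> (forall x y, P x -> P y -> P (x + y)) ->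
  forall x, P x.
Proof.
move=> P0 Pt PN PD x; have PMn y n : P y -> P (y *+ n).
  by move=> Py; elim: n => [|n IHn]; rewrite ?mulr0n // mulrS; apply: PD.
rewrite -[x](@reprK _ Q); elim/freeg_ind_dom0: (repr _) => [|k [b c] D _ _ PD'].
  by rewrite pi_zeror.
rewrite Quotient.pi_add; apply: PD PD'.
have -> : [freeg [:: (k, (b, c))]] = gen b c *~ k.
  by rewrite freegU_mulz intz.
rewrite raddfMz.
case: k => n; rewrite ?NegzE ?mulrNz -?pmulrn.
  exact: (PMn (tens b c) n (Pt b c)).
exact: (PN (tens b c *+ n.+1) (PMn _ _ (Pt b c))).
Qed.

Lemma tensor_universal (V : zmodType) (f : B -> C -> V) :
    (forall b1 b2 c, f (b1 + b2) c = f b1 c + f b2 c) ->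
    (forall b c1 c2, f b (c1 + c2) = f b c1 + f b c2) ->
    (forall b a c, f (b * under_map B a) c = f b (under_map C a * c)) ->
  exists g : {additive tensor -> V},
    (forall b c, g (tens b c) = f b c) /\
    forall g' : {additive tensor -> V},
      (forall b c, g' (tens b c) = f b c) -> g' =1 g.
Proof.
move=> fDl fDr fbal.
have [h [hB hgen]] : exists h : {freeg (B * C)} -> V,
    zmod_morphism h /\ forall b c, h (gen b c) = f b c.
  pose F (bc : B * C) : zmodule V := f bc.1 bc.2.
  exists (fglift F); split=> [x y|b c]; first exact: (@lift_is_additive int _ (zmodule V) F x y).
  by rewrite liftU /F scale1r.
have h0 : h 0 = 0 by have := hB 0 0; rewrite !subrr.
have hD x y : h (x + y) = h x + h y.
  have hN : h (- y) = - h y by have := hB 0 y; rewrite h0 !sub0r.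
  by rewrite -[y in LHS]opprK hB hN opprK.
have hR x y : x - y \in tensor_relations -> h x = h y.
  move=> /asboolP xyR; apply/eqP; rewrite -subr_eq0 -hB.
  apply: (xyR (fun z => h z == 0)).
    split; first by rewrite unfold_in h0.
    by move=> u v; rewrite !unfold_in /= hB => /eqP-> /eqP->; rewrite subrr.
  move=> _ [b1 b2 c|b c1 c2|b a c]; rewrite unfold_in hB ?hD !hgen.
  - by rewrite fDl subrr.
  - by rewrite fDr subrr.
  - by rewrite fbal subrr.
pose g (x : tensor) : V := h (repr (x : Q)).
have gpi x : g (\pi_Q x) = h x.
  by apply: hR; rewrite Quotient.idealrBE reprK.
have gB : zmod_morphism g.
  move=> x y; rewrite -[x](@reprK _ Q) -[y](@reprK _ Q).
  have <- : \pi_Q (repr (x : Q) - repr (y : Q)) =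
            \pi_Q (repr (x : Q)) - \pi_Q (repr (y : Q)).
    by rewrite Quotient.pi_add Quotient.pi_opp.
  by rewrite !gpi hB.
pose gA : {additive tensor -> V} := HB.pack_for {additive tensor -> V} g
  (GRing.isZmodMorphism.Build _ _ g gB).
exists gA; split=> [b c|g' g'E]; first by rewrite /= gpi hgen.
apply: (tensor_ind (P := fun x => g' x = gA x)) => [|b c|x Ex|x y Ex Ey].
- by rewrite !raddf0.
- by rewrite g'E /= gpi hgen.
- by rewrite !raddfN Ex.
- by rewrite !raddfD Ex Ey.
Qed.

End Tensor.

Section RingStructure.
Variable V : zmodType.

Record ring_structure := RingStructure {
  rs_one : V;
  rs_mul : V -> V -> V;
  rs_mulA : associative rs_mul;
  rs_mul1l : left_id rs_one rs_mul;
  rs_mul1r : right_id rs_one rs_mul;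
  rs_mulDl : left_distributive rs_mul +%R;
  rs_mulDr : right_distributive rs_mul +%R
}.

(* A ring structure is determined by its multiplication. *)
Lemma ring_structure_ext (m1 m2 : ring_structure) :
  rs_mul m1 =2 rs_mul m2 -> m1 = m2.
Proof.
case: m1 m2 => [o1 m1 A1 l1 r1 dl1 dr1] [o2 m2 A2 l2 r2 dl2 dr2] /= m12.
have em : m1 = m2 by apply/funext => x; apply/funext => y; apply: m12.
case: _ / em in A2 l2 r2 dl2 dr2 {m12} *.
have eo : o1 = o2 by rewrite -[LHS]r2 l1.
by case: _ / eo in l2 r2 *; congr RingStructure; apply: Prop_irrelevance.
Qed.

(* The group V, seen as a ring through the ring structure m. *)
Definition ring_on (m : ring_structure) : Type := V.

HB.instance Definition _ m := GRing.Zmodule.on (ring_on m).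
HB.instance Definition _ m := GRing.Zmodule_isPzRing.Build (ring_on m)
  (rs_mulA m) (rs_mul1l m) (rs_mul1r m) (rs_mulDl m) (rs_mulDr m).

End RingStructure.

Definition tensor_compatible (A : pzRingType) (B C : ring_under A)
    (m : ring_structure (tensor B C)) : Prop :=
  forall (b1 b2 : B) (c1 c2 : C),
    (centralizer b1 /\ centralizer b2) \/ (centralizer c1 /\ centralizer c2) ->
  rs_mul m (tens b1 c1) (tens b2 c2) = tens (b1 * b2) (c1 * c2).

Definition centrally_commute (A : pzRingType) (B C D : ring_under A)
    (fg : under_hom B D * under_hom C D) : Prop :=
  forall b c, centralizer b -> centralizer c -> fg.1 b * fg.2 c = fg.2 c * fg.1 b.

(* Main.v *)
(** Since [B] is spanned by products [a * z] with [a] from [A] and [z] in the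
    centralizer [C_B(A)], and likewise for [C], the group [M], the tensor product
    of [B] and [C], is spanned by the tensors [b (x) w] with [w] in [C_C(A)], and
    also by the tensors [z (x) c] with [z] in [C_B(A)].  Left multiplication by
    such [b (x) w] and right multiplication by such [z (x) c] are well defined on
    [M] and commute with each other.  Hence evaluation at [1 (x) 1] is a bijection
    from the ring of endomorphisms of [M] commuting with these right
    multiplications onto [M], and it transports the ring structure.  Conversely, a
    compatible multiplication satisfies the product formula as soon as [c1]
    centralizes [A] (write [c2] as a sum of [a * w] and move [a] to the left
    factor), which determines it and gives the universal property. *)

Require Import Defs.
From HB Require Import structures.
From mathcomp Require Import all_boot all_algebra boolp.

Set Implicit Arguments.
Unset Strict Implicit.
Unset Printing Implicit Defensive.

Import GRing.Theory.
Local Open Scope ring_scope.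

(** * Extensionality of morphisms over [A] *)

Lemma rmorphism_ext (R S : pzRingType) (f g : {rmorphism R -> S}) :
  f =1 g -> f = g.
Proof.
case: f g => [f [[fD] [fM]]] [g [[gD] [gM]]] /= /funext fg.
case: _ / fg in gD gM *.
by rewrite (Prop_irrelevance fD gD) (Prop_irrelevance fM gM).
Qed.

Lemma under_hom_ext (A : pzRingType) (X Y : ring_under A) (f g : under_hom X Y) :
  f =1 g -> f = g.
Proof.
case: f g => [f fP] [g gP] /= /rmorphism_ext fg.
by case: _ / fg in gP *; rewrite (Prop_irrelevance fP gP).
Qed.

(** * Additive generation of an [A]-algebra *)

Section AlgebraTheory.
Variables (A : pzRingType) (B : ring_under A).

Lemma centralizer1 : centralizer (1 : B).
Proof. by move=> a; rewrite /GRing.comm mul1r mulr1. Qed.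

Lemma centralizerM (x y : B) :
  centralizer x -> centralizer y -> centralizer (x * y).
Proof. by move=> xZ yZ a; apply/commr_sym/commrM; apply/commr_sym. Qed.

Hypothesis algB : is_algebra B.

(** Products [a * z] with [z] centralizing [A] are closed under multiplication, so the additive
    group they span is already a subring, hence all of [B]. *)
Lemma algebra_ind (P : B -> Prop) :
    (forall x y, P x -> P y -> P (x - y)) ->
    (forall a z, centralizer z -> P (under_map B a * z)) ->
  forall x, P x.
Proof.
move=> PB PZ x.
(* [S] is the span itself, defined as an intersection: [P] may fail to be stable under products,
   while [S] is a subring. *)
pose S : {pred B} := fun x => `[< forall Q : B -> Prop,
  (forall x y, Q x -> Q y -> Q (x - y)) ->
  (forall a z, centralizer z -> Q (under_map B a * z)) -> Q x >].
suff /asboolP xS : x \in S by exact: xS PB PZ.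
apply: algB; first split.
- apply/asboolP => Q _ QZ; rewrite -[1]mulr1 -{1}(rmorph1 (under_map B)).
  exact: QZ centralizer1.
- move=> u v /asboolP uS /asboolP vS; apply/asboolP => Q QB QZ.
  exact: QB (uS _ QB QZ) (vS _ QB QZ).
- move=> u v /asboolP uS /asboolP vS; apply/asboolP => Q QB QZ.
  apply: (uS (fun u => Q (u * v))) => [p q Qp Qq|a z zZ].
    by rewrite mulrBl; apply: QB.
  apply: (vS (fun v => Q (_ * v))) => [p q Qp Qq|a' z' z'Z].
    by rewrite mulrBr; apply: QB.
  (* Commuting [z] past the image of [a'] turns the product into (a a')(z z'). *)
  rewrite -mulrA (mulrA z) zZ -!mulrA mulrA -rmorphM.
  by apply/QZ/centralizerM.
- move=> a; apply/asboolP => Q _ QZ; rewrite -[X in Q X]mulr1.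
  exact: QZ centralizer1.
- move=> z zZ; apply/asboolP => Q _ QZ.
  by rewrite -[z]mul1r -(rmorph1 (under_map B)); apply: QZ.
Qed.

End AlgebraTheory.

(** * Spanning tensors and one-sided multiplications *)

Section TensorTheory.
Variables (A : pzRingType) (B C : ring_under A).
Local Notation M := (tensor B C).

Lemma tens0l c : tens (0 : B) (c : C) = 0.
Proof. by apply: (addrI (tens 0 c)); rewrite -tensDl !addr0. Qed.

Lemma tensBl b1 b2 c : tens (b1 - b2 : B) (c : C) = tens b1 c - tens b2 c.
Proof. by apply: (addIr (tens b2 c)); rewrite -tensDl !subrK. Qed.

Lemma tensBr b c1 c2 : tens (b : B) (c1 - c2 : C) = tens b c1 - tens b c2.
Proof. by apply: (addIr (tens b c2)); rewrite -tensDr !subrK. Qed.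

Lemma tensor_indB (P : M -> Prop) :
    (forall x y, P x -> P y -> P (x - y)) -> (forall b c, P (tens b c)) ->
  forall x, P x.
Proof.
move=> PB Pt; have P0 : P 0 by rewrite -(tens0l 0).
apply: tensor_ind => // [x Px|x y Px Py]; first by rewrite -sub0r; apply: PB.
by rewrite -[y]opprK -[X in _ - X]sub0r; apply: (PB) => //; apply: PB.
Qed.

(** In [tens b (a * w)] the coefficient [a] moves across to [b], leaving [w] on the right. *)
Lemma tensor_ind_centralr (algC : is_algebra C) (P : M -> Prop) :
    (forall x y, P x -> P y -> P (x - y)) ->
    (forall b w, centralizer w -> P (tens b w)) ->
  forall x, P x.
Proof.
move=> PB Pt; apply: tensor_indB => // b.
apply: (algebra_ind algC) => [x y Px Py|a w wZ]; first by rewrite tensBr; apply: PB.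
by rewrite -tens_bal; apply: Pt.
Qed.

Lemma tensor_ind_centrall (algB : is_algebra B) (P : M -> Prop) :
    (forall x y, P x -> P y -> P (x - y)) ->
    (forall z c, centralizer z -> P (tens z c)) ->
  forall x, P x.
Proof.
move=> PB Pt; apply: tensor_indB => // b c; move: b.
apply: (algebra_ind algB) => [x y Px Py|a z zZ]; first by rewrite tensBl; apply: PB.
by rewrite -zZ tens_bal; apply: Pt.
Qed.

(** The map is balanced because [w] commutes with the image of [A]. *)
Lemma tensor_left_mul b (w : C) : centralizer w ->
  exists l : {additive M -> M}, forall x y, l (tens x y) = tens (b * x) (w * y).
Proof.
move=> wZ; have [|||l [lE _]] := @tensor_universal _ B C M
  (fun x y => tens (b * x) (w * y)); last by exists l.
- by move=> *; rewrite mulrDr tensDl.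
- by move=> *; rewrite mulrDr tensDr.
- by move=> x a y; rewrite !mulrA wZ tens_bal mulrA.
Qed.

Lemma tensor_right_mul (z : B) c : centralizer z ->
  exists r : {additive M -> M}, forall x y, r (tens x y) = tens (x * z) (y * c).
Proof.
move=> zZ; have [|||r [rE _]] := @tensor_universal _ B C M
  (fun x y => tens (x * z) (y * c)); last by exists r.
- by move=> *; rewrite mulrDl tensDl.
- by move=> *; rewrite mulrDl tensDr.
- by move=> x a y; rewrite -!mulrA -zZ mulrA tens_bal.
Qed.

(** With no product on [M] yet, right multiplication by [tens z c] enters as any additive [r] with
    the expected values on pure tensors. *)
Definition right_linear (l : M -> M) : Prop :=
  forall (z : B) (c : C) (r : {additive M -> M}), centralizer z ->
    (forall x y, r (tens x y) = tens (x * z) (y * c)) ->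
  forall x, l (r x) = r (l x).

Lemma left_mul_right_linear b (w : C) (l : {additive M -> M}) :
  (forall x y, l (tens x y) = tens (b * x) (w * y)) -> right_linear l.
Proof.
move=> lE z c r zZ rE; apply: tensor_indB => [x y Px Py|x y].
  by rewrite !raddfB Px Py.
by rewrite rE !lE rE !mulrA.
Qed.

(** * Existence of the ring structure, through right linear endomorphisms *)

Section Algebras.
Hypotheses (algB : is_algebra B) (algC : is_algebra C).

(** The tensors [tens z c] with [z] centralizing [A] span, and each is the image of [tens 1 1] under
    a right multiplication. *)
Lemma right_linear_inj (l l' : {additive M -> M}) :
    right_linear l -> right_linear l' -> l (tens 1 1) = l' (tens 1 1) ->
  l =1 l'.
Proof.
move=> lR l'R e; apply: (tensor_ind_centrall algB) => [x y Px Py|z c zZ].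
  by rewrite !raddfB Px Py.
have [r rE] := tensor_right_mul c zZ.
have -> : tens z c = r (tens 1 1) by rewrite rE !mul1r.
by rewrite (lR _ _ _ zZ rE) (l'R _ _ _ zZ rE) e.
Qed.

Lemma right_linear_surj (x : M) :
  exists l : {additive M -> M}, right_linear l /\ l (tens 1 1) = x.
Proof.
elim/(tensor_ind_centralr algC): x => [x y [l [lR <-]] [l' [l'R <-]]|b w wZ].
  exists (l \- l') => /=; split=> // z c r zZ rE x0 /=.
  by rewrite (lR _ _ _ zZ rE) (l'R _ _ _ zZ rE) raddfB.
have [l lE] := tensor_left_mul b wZ.
by exists l; rewrite lE !mulr1; split=> //; apply: left_mul_right_linear lE.
Qed.

Lemma tensor_ring_exists : exists m : ring_structure M, tensor_compatible m.
Proof.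
(* [L x] is the endomorphism with value [x] at [tens 1 1]; the product of [x] and [y] will be
   [L x y]. Associativity, the left unit law and left distributivity come from comparing right
   linear maps at [tens 1 1], by [LU]. *)
pose L x := sval (cid (right_linear_surj x)).
have LR x : right_linear (L x) by case: (svalP (cid (right_linear_surj x))).
have L1 x : L x (tens 1 1) = x by case: (svalP (cid (right_linear_surj x))).
have LU (l : {additive M -> M}) x : right_linear l -> l (tens 1 1) = x -> l =1 L x.
  by move=> lR lx; apply: right_linear_inj; rewrite ?L1.
have LA : associative (fun x y => L x y).
  move=> x y z; rewrite /=; apply: (LU (L x \o L y)) => [u c r uZ rE t|] /=.
    by rewrite (LR _ _ _ _ uZ rE) (LR _ _ _ _ uZ rE).
  by rewrite L1.
have L1l : left_id (tens 1 1) (fun x y => L x y).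
  by move=> x; rewrite -(LU idfun).
have LDl : left_distributive (fun x y => L x y) +%R.
  move=> x y z; rewrite -(LU (L x \+ L y)) //= => [u c r uZ rE t|] /=.
    by rewrite (LR _ _ _ _ uZ rE) (LR _ _ _ _ uZ rE) raddfD.
  by rewrite !L1.
have LDr : right_distributive (fun x y => L x y) +%R.
  by move=> x y z; rewrite raddfD.
(* If [b2] is central over [A], [tens b2 c2] arises by a right multiplication, which commutes with
   [L]; if [c1] is, [L (tens b1 c1)] is an explicit left multiplication. *)
exists (RingStructure LA L1l L1 LDl LDr) => b1 b2 c1 c2 /= [[_ zZ]|[wZ _]].
  have [r rE] := tensor_right_mul c2 zZ.
  have -> : tens b2 c2 = r (tens 1 1) by rewrite rE !mul1r.
  by rewrite (LR _ _ _ _ zZ rE) L1 rE.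
have [l lE] := tensor_left_mul b1 wZ.
rewrite -(LU l) //; first exact: left_mul_right_linear lE.
by rewrite lE !mulr1.
Qed.

(** * Product formulas for a compatible structure, and uniqueness *)

Section Compatible.
Variables (m : ring_structure M) (mP : tensor_compatible m).

Lemma rs_mulBl x y z : rs_mul m (x - y) z = rs_mul m x z - rs_mul m y z.
Proof. exact: (@mulrBl (ring_on m)). Qed.

Lemma rs_mulBr x y z : rs_mul m x (y - z) = rs_mul m x y - rs_mul m x z.
Proof. exact: (@mulrBr (ring_on m)). Qed.

Lemma compatible_centralr (b1 b2 : B) (w c : C) : centralizer w ->
  rs_mul m (tens b1 w) (tens b2 c) = tens (b1 * b2) (w * c).
Proof.
move=> wZ; elim/(algebra_ind algC): c => [x y Px Py|a w' w'Z].
  by rewrite tensBr rs_mulBr Px Py -tensBr mulrBr.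
(* Once [a] sits in the left factor, both right factors [w] and [w'] centralize [A], so
   compatibility applies. *)
by rewrite -tens_bal mP; [rewrite mulrA tens_bal !mulrA wZ | right].
Qed.

Lemma compatible_centrall (b z : B) (c1 c2 : C) : centralizer z ->
  rs_mul m (tens b c1) (tens z c2) = tens (b * z) (c1 * c2).
Proof.
move=> zZ; elim/(algebra_ind algB): b => [x y Px Py|a z' z'Z].
  by rewrite tensBl rs_mulBl Px Py -tensBl mulrBl.
rewrite -z'Z tens_bal mP; last by left.
by rewrite -!mulrA -tens_bal -mulrA zZ.
Qed.

(** By the product formula [tens 1 1] is a left unit, hence equal to the right unit. *)
Lemma compatible_one : rs_one m = tens 1 1.
Proof.
rewrite -[RHS](rs_mul1r m).
elim/tensor_indB: (rs_one m) => [x y Px Py|b c]; first by rewrite rs_mulBr -Px -Py.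
by rewrite (compatible_centralr _ _ _ (@centralizer1 _ C)) !mul1r.
Qed.

End Compatible.

Lemma tensor_ring_unique (m1 m2 : ring_structure M) :
  tensor_compatible m1 -> tensor_compatible m2 -> m1 = m2.
Proof.
move=> m1P m2P; apply: ring_structure_ext => x.
elim/(tensor_ind_centralr algC): x => [x x' Px Px' y|b w wZ].
  by rewrite !rs_mulBl Px Px'.
elim/tensor_indB=> [x y Px Py|b' c]; first by rewrite !rs_mulBr Px Py.
by rewrite !compatible_centralr.
Qed.


(** * From commuting pairs to homomorphisms on the tensor product *)

Section HomOfPair.
Variables (D : ring_under A) (f : under_hom B D) (g : under_hom C D).

(** For [b = a * z], [g c] passes [f z] by hypothesis, and passes the image of [a] because [f] and
    [g] agree on [A] and [c] centralizes [A]. *)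
Lemma centrally_commute_left : centrally_commute (f, g) ->
  forall b c, centralizer c -> f b * g c = g c * f b.
Proof.
move=> fgC b w wZ; elim/(algebra_ind algB): b => [x y Px Py|a z zZ].
  by rewrite raddfB mulrBl mulrBr Px Py.
have zw := fgC z w zZ wZ; rewrite /= in zw.
rewrite rmorphM -mulrA zw mulrA (under_homP f) -(under_homP g) -rmorphM -wZ.
by rewrite rmorphM mulrA.
Qed.

Lemma centrally_commute_right : centrally_commute (f, g) ->
  forall b c, centralizer b -> f b * g c = g c * f b.
Proof.
move=> fgC z c zZ; elim/(algebra_ind algC): c => [x y Px Py|a w wZ].
  by rewrite raddfB mulrBl mulrBr Px Py.
have zw := fgC z w zZ wZ; rewrite /= in zw.
rewrite rmorphM -[RHS]mulrA -zw !mulrA (under_homP g) -(under_homP f).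
by rewrite -!rmorphM zZ.
Qed.

Lemma tensor_pair_hom (m : ring_structure M) : tensor_compatible m ->
    centrally_commute (f, g) ->
  exists h : {rmorphism ring_on m -> D}, forall b c, h (tens b c) = f b * g c.
Proof.
move=> mP fgC; have [|||h [hE _]] := @tensor_universal _ B C D (fun b c => f b * g c).
- by move=> *; rewrite rmorphD mulrDl.
- by move=> *; rewrite rmorphD mulrDr.
- by move=> b a c; rewrite !rmorphM (under_homP f) (under_homP g) mulrA.
have hM x y : h (rs_mul m x y) = h x * h y.
  (* Taking the left argument of the form [tens b w] makes the product explicit; it then remains to
     commute [g w] past [f b']. *)
  elim/(tensor_ind_centralr algC): x => [x x' Px Px'|b w wZ].
    by rewrite rs_mulBl !raddfB mulrBl Px Px'.
  elim/tensor_indB: y => [y y' Py Py'|b' c].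
    by rewrite rs_mulBr !raddfB mulrBr Py Py'.
  rewrite compatible_centralr // !hE !rmorphM -!mulrA; congr (_ * _).
  by rewrite !mulrA centrally_commute_left.
have h1 : h (rs_one m) = 1.
  by rewrite compatible_one // hE !rmorph1 mulr1.
pose h' : {rmorphism ring_on m -> D} := HB.pack_for {rmorphism ring_on m -> D}
  (h : ring_on m -> D)
  (GRing.isZmodMorphism.Build (ring_on m) D (h : ring_on m -> D) (raddfB h))
  (GRing.isMonoidMorphism.Build (ring_on m) D (h : ring_on m -> D) (h1, hM)).
by exists h'.
Qed.

End HomOfPair.

(** * The canonical maps into the tensor product and the universal property *)

Section Inclusions.
Variables (m : ring_structure M) (mP : tensor_compatible m).

Lemma tensor_inl : exists j : {rmorphism B -> ring_on m}, forall b, j b = tens b 1.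
Proof.
pose j b : ring_on m := tens b 1.
have jB : zmod_morphism j by move=> x y; apply: tensBl.
have jM : monoid_morphism j.
  split=> [|x y]; first exact/esym/compatible_one.
  by rewrite -[RHS]/(rs_mul m _ _) (compatible_centralr mP) ?mulr1 //; apply: centralizer1.
by exists (HB.pack_for {rmorphism B -> ring_on m} j
  (GRing.isZmodMorphism.Build _ _ j jB) (GRing.isMonoidMorphism.Build _ _ j jM)).
Qed.

Lemma tensor_inr : exists j : {rmorphism C -> ring_on m}, forall c, j c = tens 1 c.
Proof.
pose j c : ring_on m := tens 1 c.
have jB : zmod_morphism j by move=> x y; apply: tensBr.
have jM : monoid_morphism j.
  split=> [|x y]; first exact/esym/compatible_one.
  by rewrite -[RHS]/(rs_mul m _ _) (compatible_centrall mP) ?mulr1 //; apply: centralizer1.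
by exists (HB.pack_for {rmorphism C -> ring_on m} j
  (GRing.isZmodMorphism.Build _ _ j jB) (GRing.isMonoidMorphism.Build _ _ j jM)).
Qed.

Variables (jA : {rmorphism A -> ring_on m}) (jB : {rmorphism B -> ring_on m})
          (jC : {rmorphism C -> ring_on m}).
Hypotheses (jAl : forall a, jA a = tens (under_map B a) 1)
           (jAr : forall a, jA a = tens 1 (under_map C a))
           (jBE : forall b, jB b = tens b 1) (jCE : forall c, jC c = tens 1 c).

Lemma inl_mul_inr b c : jB b * jC c = tens b c.
Proof.
rewrite jBE jCE -[LHS]/(rs_mul m _ _) (compatible_centralr mP) ?mulr1 ?mul1r //.
exact: centralizer1.
Qed.

Lemma inr_mul_inl_centralr b w : centralizer w -> jC w * jB b = tens b w.
Proof.
move=> wZ; rewrite jBE jCE -[LHS]/(rs_mul m _ _) (compatible_centralr mP) //.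
by rewrite mulr1 mul1r.
Qed.

Lemma inr_mul_inl_centrall z c : centralizer z -> jC c * jB z = tens z c.
Proof.
move=> zZ; rewrite jBE jCE -[LHS]/(rs_mul m _ _) (compatible_centrall mP) //.
by rewrite mulr1 mul1r.
Qed.

Lemma tensor_hom_bij (D : ring_under A) :
  exists Phi : under_hom (RingUnder jA) D ->
               {fg : under_hom B D * under_hom C D | centrally_commute fg},
    bijective Phi /\
    forall h b c,
      [/\ (sval (Phi h)).1 b = h (tens b 1), (sval (Phi h)).2 c = h (tens 1 c)
        & h (tens b c) = (sval (Phi h)).1 b * (sval (Phi h)).2 c].
Proof.
have fP (h : under_hom (RingUnder jA) D) a : (h \o jB) (under_map B a) = under_map D a.
  by rewrite /= jBE -jAl (under_homP h).
have gP (h : under_hom (RingUnder jA) D) a : (h \o jC) (under_map C a) = under_map D a.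
  by rewrite /= jCE -jAr (under_homP h).
pose fg h := (UnderHom (fP h), UnderHom (gP h)).
have fgC h : centrally_commute (fg h).
  (* Both products of [jB b] and [jC c] equal [tens b c]. *)
  by move=> b c _ cZ; rewrite /= -!rmorphM inl_mul_inr inr_mul_inl_centralr.
have fgM (h : under_hom (RingUnder jA) D) b c : h (tens b c) = (fg h).1 b * (fg h).2 c.
  by rewrite /= -rmorphM inl_mul_inr.
pose Phi h : {fg : under_hom B D * under_hom C D | centrally_commute fg} :=
  exist _ (fg h) (fgC h).
exists Phi; split; last first.
  by move=> h b c; split; [rewrite /= jBE | rewrite /= jCE | apply: fgM].
have PsiP (p : {fg : under_hom B D * under_hom C D | centrally_commute fg}) :
    exists h : under_hom (RingUnder jA) D,
      forall b c, h (tens b c) = (sval p).1 b * (sval p).2 c.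
  case: p => [[f g] fgc] /=; have [h hE] := tensor_pair_hom mP fgc.
  have hP a : h (under_map (RingUnder jA) a) = under_map D a.
    by rewrite /= jAl hE rmorph1 mulr1 (under_homP f).
  by exists (UnderHom hP).
(* The inverse is picked by choice; its values on pure tensors determine it, since these span. *)
pose Psi p := sval (cid (PsiP p)).
have PsiE p b c : Psi p (tens b c) = (sval p).1 b * (sval p).2 c.
  exact: (svalP (cid (PsiP p))).
exists Psi => [h|p].
  apply: under_hom_ext; apply: tensor_indB => [x y Px Py|b c].
    by rewrite (raddfB (Psi (Phi h)) x y) (raddfB h x y); congr (_ - _).
  by rewrite PsiE fgM.
move: (Psi p) (PsiE p) => h; case: p => [[f g] fgc] /= E; apply: eq_exist.
congr pair; apply: under_hom_ext => x /=.
  by rewrite jBE E rmorph1 mulr1.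
by rewrite jCE E rmorph1 mul1r.
Qed.

(** * The tensor product as an algebra over [B], [C] and [A] *)

Lemma is_algebra_inl : is_algebra (RingUnder jB).
Proof.
move=> S [S1 SB SM] SjB SZ; apply: (tensor_ind_centralr algC) => [|b w wZ].
  exact: SB.
rewrite -inl_mul_inr; apply: SM; first exact: SjB.
(* [jC w] commutes with every [jB b'], both products being [tens b' w]. *)
by apply: SZ => b'; rewrite /GRing.comm /= inl_mul_inr inr_mul_inl_centralr.
Qed.

Lemma is_algebra_inr : is_algebra (RingUnder jC).
Proof.
move=> S [S1 SB SM] SjC SZ; apply: (tensor_ind_centrall algB) => [|z c zZ].
  exact: SB.
rewrite -inl_mul_inr; apply: SM; last exact: SjC.
by apply: SZ => c'; rewrite /GRing.comm /= inl_mul_inr inr_mul_inl_centrall.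
Qed.

(** [jB] and [jC] carry centralizers of [A] to centralizers of [A], so [S] contains both images and
    hence every pure tensor [jB b * jC c]. *)
Lemma is_algebra_base : is_algebra (RingUnder jA).
Proof.
move=> S [S1 SB SM] SjA SZ.
have SjB b : jB b \in S.
  elim/(algebra_ind algB): b => [x y Px Py|a z zZ]; first by rewrite raddfB; apply: SB.
  rewrite rmorphM; apply: SM; first by rewrite jBE -jAl; apply: SjA.
  by apply: SZ => a'; rewrite /GRing.comm /= jAl -jBE -!rmorphM zZ.
have SjC c : jC c \in S.
  elim/(algebra_ind algC): c => [x y Px Py|a w wZ]; first by rewrite raddfB; apply: SB.
  rewrite rmorphM; apply: SM; first by rewrite jCE -jAr; apply: SjA.
  by apply: SZ => a'; rewrite /GRing.comm /= jAr -jCE -!rmorphM wZ.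
apply: tensor_indB => [|b c]; first exact: SB.
by rewrite -inl_mul_inr; apply: SM.
Qed.

End Inclusions.
End Algebras.
End TensorTheory.

(** * Assembly of the three assertions *)

Theorem proposition1p5 (A : pzRingType) (B C : ring_under A)
    (algB : is_algebra B) (algC : is_algebra C) :
  (exists! m : ring_structure (tensor B C), tensor_compatible m) /\
  forall m : ring_structure (tensor B C), tensor_compatible m ->
  exists (jA : {rmorphism A -> ring_on m}) (jB : {rmorphism B -> ring_on m})
         (jC : {rmorphism C -> ring_on m}),
  [/\ [/\ forall a, jA a = tens (under_map B a) 1,
          forall a, jA a = tens 1 (under_map C a),
          forall b, jB b = tens b 1
        & forall c, jC c = tens 1 c],
      forall D : ring_under A,
        (exists Phi : under_hom (RingUnder jA) D ->
                      {fg : under_hom B D * under_hom C D | centrally_commute fg},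
           bijective Phi /\
           forall h b c,
             [/\ (sval (Phi h)).1 b = h (tens b 1),
                 (sval (Phi h)).2 c = h (tens 1 c)
               & h (tens b c) = (sval (Phi h)).1 b * (sval (Phi h)).2 c]) /\
        (forall (f : under_hom B D) (g : under_hom C D),
           (centrally_commute (f, g) <->
            forall b c, centralizer c -> f b * g c = g c * f b) /\
           (centrally_commute (f, g) <->
            forall b c, centralizer b -> f b * g c = g c * f b))
    & [/\ is_algebra (RingUnder jB), is_algebra (RingUnder jC)
        & is_algebra (RingUnder jA)]].
Proof.
split=> [|m mP].
  have [m mP] := tensor_ring_exists algB algC.
  by exists m; split=> // m' m'P; apply: tensor_ring_unique.
have [jB jBE] := tensor_inl algC mP; have [jC jCE] := tensor_inr algB algC mP.
pose jA : {rmorphism A -> ring_on m} := jB \o under_map B.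
have jAl a : jA a = tens (under_map B a) 1 by rewrite /= jBE.
have jAr a : jA a = tens 1 (under_map C a).
  by rewrite jAl -[under_map B a]mul1r tens_bal mulr1.
exists jA, jB, jC; split=> // [D|].
  split=> [|f g]; first exact: (tensor_hom_bij algB algC mP jAl jAr jBE jCE).
  split; split.
  - exact: centrally_commute_left.
  - by move=> fgC b c _; apply: fgC.
  - exact: centrally_commute_right.
  - by move=> fgC b c bZ _; apply: fgC.
split.
- exact: (is_algebra_inl algC mP jBE jCE).
- exact: (is_algebra_inr algB algC mP jBE jCE).
- exact: (is_algebra_base algB algC mP jAl jAr jBE jCE).
Qed.
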